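(* The time evolution operators $\{T_\ell\}_{\ell\ge1}$ of the box-basket-ball system commute with each other: for all integers $k,\ell\ge1$ and every state $S$, $T_kT_\ell(S)=T_\ell T_k(S)$.
   Context: Box-basket-ball system. A site state is a triple $(d,e,f)$ of nonnegative integers with $d=e-f+1$ (one box, $e$ baskets, $f$ balls); $V=(1,0,0)$. A state is a sequence $(S_i)_{i\in\mathbb Z}$ of site states with $S_i=V$ for all but finitely many $i$. The map $R$ sends a carrier $(a,b,c)$ and a site $(d,e,f)$ to a site $(d',e',f')$ and a carrier $(a',b',c')$ with $d'=d+\min(a+b,a+c,b+f)-\min(e+c,d+c,d+b)$, $e'=e+\min(a+b,a+c,b+f)-\min(a+e,d+f,e+f)$, $f'=f+\min(e+c,d+c,d+b)-\min(a+e,d+f,e+f)$, $a'=a-\min(a+b,a+c,b+f)+\min(e+c,d+c,d+b)$, $b'=b-\min(a+b,a+c,b+f)+\min(a+e,d+f,e+f)$, $c'=c-\min(e+c,d+c,d+b)+\min(a+e,d+f,e+f)$. Time evolution $T_\ell$ (integer $\ell\ge1$): a carrier starting in state $u_\ell=(\ell,0,0)$ to the left of all non-vacuum sites passes the sites from left to right, each site being updated by $R$ (the carrier returns to $u_\ell$ after passing sufficiently many vacuum sites at the right); the new state consists of the updated sites. $R$ is the tropicalization of a whurl relation and satisfies the Yang–Baxter relation. *)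

(* Defs.v *)
From Stdlib Require Import ZArith.
Open Scope Z_scope.

Definition triple := (Z * Z * Z)%type.

Definition site_ok (x : triple) : Prop :=
  let '(d, e, f) := x in 0 <= d /\ 0 <= e /\ 0 <= f /\ d = e - f + 1.

Definition V : triple := (1, 0, 0).

Definition R (car site : triple) : triple * triple :=
  let '(a, b, c) := car in
  let '(d, e, f) := site in
  let m1 := Z.min (Z.min (a + b) (a + c)) (b + f) in
  let m2 := Z.min (Z.min (e + c) (d + c)) (d + b) in
  let m3 := Z.min (Z.min (a + e) (d + f)) (e + f) in
  ((d + m1 - m2, e + m1 - m3, f + m2 - m3),
   (a - m1 + m2, b - m1 + m3, c - m2 + m3)).

(* A state is a function Z -> triple; [L] is a position such that all sites
   strictly left of [L] are vacuum.  The carrier starts in state (l,0,0) just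
   to the left of site L.  [carr l L s n] is the carrier after passing the
   sites L, L+1, ..., L+n-1. *)
Fixpoint carr (l L : Z) (s : Z -> triple) (n : nat) : triple :=
  match n with
  | O => (l, 0, 0)
  | S n' => snd (R (carr l L s n') (s (L + Z.of_nat n')))
  end.

Definition T (l L : Z) (s : Z -> triple) : Z -> triple :=
  fun i => if i <? L then s i
           else fst (R (carr l L s (Z.to_nat (i - L))) (s i)).

Definition is_state (s : Z -> triple) : Prop :=
  (forall i, site_ok (s i)) /\ exists N, forall i, N < Z.abs i -> s i = V.

(* Main.v *)
Require Import Defs.
From Stdlib Require Import ZArith.
From Stdlib Require Import Lia Ring.
Open Scope Z_scope.

(* The map [R] satisfies the Yang-Baxter relation for all integer arguments, and
    exchanges the carriers [(k,0,0)] and [(l,0,0)].  Sliding the crossing of the two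
    carriers along the sites then shows that both orders of evolution give the same
    sites.  For Yang-Baxter, the first output is computed from three subtraction-free
    polynomial identities read in the min-plus semiring; the third output follows by the
    symmetry that reverses triples and swaps carrier and site, and the second by the
    conservation of carrier + site. *)

(** [None] is plus infinity, the additive zero that [ring] expects of a semiring. *)
Definition trop_add (x y : option Z) : option Z :=
  match x, y with
  | Some a, Some b => Some (Z.min a b)
  | None, _ => y
  | _, None => x
  end.

Definition trop_mul (x y : option Z) : option Z :=
  match x, y with
  | Some a, Some b => Some (a + b)
  | _, _ => None
  end.

Lemma trop_semi_ring :
  semi_ring_theory None (Some 0) trop_add trop_mul (@eq (option Z)).
Proof.
  constructor; repeat intros [?|]; intros; cbn;
    try reflexivity; f_equal; lia.
Qed.

Add Ring trop_ring : trop_semi_ring.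

Lemma trop_inj (x y : Z) : Some x = Some y -> x = y.
Proof. congruence. Qed.

Lemma trop_min (x y : Z) : Some (Z.min x y) = trop_add (Some x) (Some y).
Proof. reflexivity. Qed.

Lemma trop_plus (x y : Z) : Some (x + y) = trop_mul (Some x) (Some y).
Proof. reflexivity. Qed.

(* The identities have equal multiplicities on both sides, so [ring] proves them
   without idempotency of [Z.min]. *)
Ltac tropical_ring := apply trop_inj; repeat (rewrite trop_min || rewrite trop_plus); ring.

Definition w1 (car site : triple) : Z :=
  let '(a, b, c) := car in let '(d, e, f) := site in
  Z.min (Z.min (a + b) (a + c)) (b + f).

Definition w2 (car site : triple) : Z :=
  let '(a, b, c) := car in let '(d, e, f) := site in
  Z.min (Z.min (e + c) (d + c)) (d + b).

Definition w3 (car site : triple) : Z :=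
  let '(a, b, c) := car in let '(d, e, f) := site in
  Z.min (Z.min (a + e) (d + f)) (e + f).

Ltac triple_lia := repeat apply (f_equal2 pair); lia.

Lemma R_w (a b c d e f m1 m2 m3 : Z) :
  w1 (a, b, c) (d, e, f) = m1 -> w2 (a, b, c) (d, e, f) = m2 ->
  w3 (a, b, c) (d, e, f) = m3 ->
  R (a, b, c) (d, e, f) =
    ((d + m1 - m2, e + m1 - m3, f + m2 - m3),
     (a - m1 + m2, b - m1 + m3, c - m2 + m3)).
Proof. now intros <- <- <-. Qed.

Section FirstOutput.

Variables a b c u v w d e f : Z.

Let q1 := w1 (a, b, c) (u, v, w).
Let q2 := w2 (a, b, c) (u, v, w).
Let q3 := w3 (a, b, c) (u, v, w).
Let m1 := w1 (u, v, w) (d, e, f).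
Let m2 := w2 (u, v, w) (d, e, f).
Let m3 := w3 (u, v, w) (d, e, f).

(* Clearing denominators, the [n]'s are the numerators of the minima met by the site
   at its second crossing on one side of Yang-Baxter, the [p]'s those of its first
   crossing on the other side. *)
Let n1 := Z.min (Z.min (a + b + m3) (a + c + m3)) (b + f + m2).
Let n2 := Z.min (Z.min (e + c + m2) (d + c + m3)) (d + b + m3).
Let n3 := Z.min (Z.min (a + e + m3) (d + f + m3)) (e + f + m2).
Let p1 := Z.min (Z.min (a + b + q2) (a + c + q1)) (b + f + q1).
Let p2 := Z.min (Z.min (e + c + q1) (d + c + q1)) (d + b + q2).
Let p3 := Z.min (Z.min (a + e + q2) (d + f + q1)) (e + f + q1).

(** On the left of this and the next two identities stand the cleared minima of the second crossing
    on the side of the [p]s. Each factors, in min-plus terms, as an [n] times two of the [q]s. *)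
Lemma site_w1_poly :
  Z.min (Z.min (u + v + q1 + p3) (u + w + q2 + p3)) (v + f + q3 + p2)
  = n1 + q2 + q3.
Proof.
  unfold n1, p2, p3, q1, q2, q3, m2, m3, w1, w2, w3; tropical_ring.
Qed.

Lemma site_w2_poly :
  Z.min (Z.min (e + w + q3 + p2) (d + w + q2 + p3)) (d + v + q1 + p3)
  = n2 + q1 + q3.
Proof.
  unfold n2, p2, p3, q1, q2, q3, m2, m3, w1, w2, w3; tropical_ring.
Qed.

Lemma site_w3_poly :
  Z.min (Z.min (u + e + q1 + p3) (d + f + q2 + p3)) (e + f + q3 + p2)
  = n3 + q1 + q2.
Proof.
  unfold n3, p2, p3, q1, q2, q3, m2, m3, w1, w2, w3; tropical_ring.
Qed.

Lemma yang_baxter_fst_coord :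
  fst (R (a, b, c) (fst (R (u, v, w) (d, e, f))))
  = fst (R (fst (R (a, b, c) (u, v, w)))
           (fst (R (snd (R (a, b, c) (u, v, w))) (d, e, f)))).
Proof.
  rewrite (R_w u v w d e f m1 m2 m3 eq_refl eq_refl eq_refl).
  rewrite (R_w a b c u v w q1 q2 q3 eq_refl eq_refl eq_refl).
  unfold fst at 2 4 5, snd.
  pose proof site_w1_poly as g1; pose proof site_w2_poly as g2; pose proof site_w3_poly as g3.
  (* Common factors are pulled out of each minimum. The [m]s then cancel in the final site, which is
     [(d + n1 - n2, e + n1 - n3, f + n2 - n3)]. *)
  rewrite (R_w a b c _ _ _ (n1 - m3) (m1 + n2 - m2 - m3) (m1 + n3 - m3 - m3));
    [| unfold w1, n1; clear; lia | unfold w2, n2; clear; lia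
     | unfold w3, n3; clear; lia].
  rewrite (R_w (a - q1 + q2) _ _ d e f
             (q3 + p1 - q1 - q1) (q3 + p2 - q1 - q2) (p3 - q1));
    [| unfold w1, p1; clear; lia | unfold w2, p2; clear; lia
     | unfold w3, p3; clear; lia].
  unfold fst at 2.
  (* These values come from [g1], [g2], [g3]; the [p]s and [q]s cancel against the first crossing,
     leaving the same final site. *)
  rewrite (R_w (u + q1 - q2) _ _ _ _ _
             (q1 + n1 - p3) (n2 + p1 + q2 - p2 - p3) (n3 + p1 + q3 - p3 - p3)).
  - cbn [fst]; triple_lia.
  - unfold w1; revert g1; clear; lia.
  - unfold w2; revert g2; clear; lia.
  - unfold w3; revert g3; clear; lia.
Qed.

End FirstOutput.

Lemma yang_baxter_fst (A B X : triple) :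
  fst (R A (fst (R B X)))
  = fst (R (fst (R A B)) (fst (R (snd (R A B)) X))).
Proof.
  destruct A as [[a b] c], B as [[u v] w], X as [[d e] f].
  apply yang_baxter_fst_coord.
Qed.

Definition rev3 (x : triple) : triple := let '(a, b, c) := x in (c, b, a).

Lemma rev3_inj (x y : triple) : rev3 x = rev3 y -> x = y.
Proof. destruct x as [[? ?] ?], y as [[? ?] ?]; cbn; congruence. Qed.

(** The symmetry exchanges the minima [w1] and [w3] and fixes [w2]. *)
Lemma R_rev3 (A X : triple) :
  R (rev3 X) (rev3 A) = (rev3 (snd (R A X)), rev3 (fst (R A X))).
Proof.
  destruct A as [[a b] c], X as [[d e] f].
  rewrite (R_w a b c d e f _ _ _ eq_refl eq_refl eq_refl).
  set (m1 := w1 _ _); set (m2 := w2 _ _); set (m3 := w3 _ _).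
  unfold rev3, fst, snd.
  rewrite (R_w f e d c b a m3 m2 m1);
    [triple_lia | ..]; unfold m1, m2, m3, w1, w2, w3; lia.
Qed.

Lemma yang_baxter_snd (A B X : triple) :
  snd (R (snd (R A (fst (R B X)))) (snd (R B X)))
  = snd (R (snd (R A B)) X).
Proof.
  apply rev3_inj.
  (* Reversing the order of the inputs also interchanges the two sides of Yang-Baxter, hence the
     final [symmetry]. *)
  pose proof (yang_baxter_fst (rev3 X) (rev3 B) (rev3 A)) as H.
  repeat (rewrite ?R_rev3 in H; cbn [fst snd] in H).
  now symmetry.
Qed.

Definition add3 (x y : triple) : triple :=
  let '(a, b, c) := x in let '(d, e, f) := y in (a + d, b + e, c + f).

Lemma R_add3 (A X : triple) : add3 (fst (R A X)) (snd (R A X)) = add3 A X.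
Proof.
  destruct A as [[a b] c], X as [[d e] f].
  rewrite (R_w a b c d e f _ _ _ eq_refl eq_refl eq_refl).
  generalize (w1 (a, b, c) (d, e, f)) (w2 (a, b, c) (d, e, f))
    (w3 (a, b, c) (d, e, f)); intros.
  cbn; triple_lia.
Qed.

Lemma add3_assoc (x y z : triple) : add3 x (add3 y z) = add3 (add3 x y) z.
Proof.
  destruct x as [[? ?] ?], y as [[? ?] ?], z as [[? ?] ?]; cbn; triple_lia.
Qed.

Lemma add3_cancel_l (x y z : triple) : add3 x y = add3 x z -> y = z.
Proof.
  destruct x as [[? ?] ?], y as [[? ?] ?], z as [[? ?] ?]; cbn.
  intros [= H1 H2 H3]; triple_lia.
Qed.

Lemma add3_cancel_r (x y z : triple) : add3 y x = add3 z x -> y = z.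
Proof.
  destruct x as [[? ?] ?], y as [[? ?] ?], z as [[? ?] ?]; cbn.
  intros [= H1 H2 H3]; triple_lia.
Qed.

Lemma yang_baxter_crossing (A B X : triple) :
  R (snd (R A (fst (R B X)))) (snd (R B X))
  = (snd (R (fst (R A B)) (fst (R (snd (R A B)) X))), snd (R (snd (R A B)) X)).
Proof.
  rewrite (surjective_pairing (R (snd (R A (fst (R B X)))) (snd (R B X)))).
  f_equal; [| apply yang_baxter_snd].
  (* With the third and first outputs added, both sides total [A + B + X]. *)
  apply (add3_cancel_r (snd (R (snd (R A B)) X))).
  rewrite <- (yang_baxter_snd A B X) at 1; rewrite R_add3.
  apply (add3_cancel_l (fst (R A (fst (R B X))))).
  rewrite add3_assoc, R_add3, <- add3_assoc, R_add3.
  rewrite yang_baxter_fst, (add3_assoc (fst _)), R_add3, <- add3_assoc.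
  now rewrite R_add3, !add3_assoc, R_add3.
Qed.

Lemma T_at (l L : Z) (s : Z -> triple) (n : nat) :
  T l L s (L + Z.of_nat n) = fst (R (carr l L s n) (s (L + Z.of_nat n))).
Proof.
  unfold T.
  replace (L + Z.of_nat n <? L) with false by (symmetry; apply Z.ltb_ge; lia).
  now rewrite Z.add_simpl_l, Nat2Z.id.
Qed.

(** Invariant of the sweep: one crossing turns the carriers of one order into those of the other. *)
Lemma R_carr (k l L : Z) (s : Z -> triple) (n : nat) : 0 <= k -> 0 <= l ->
  R (carr k L (T l L s) n) (carr l L s n)
  = (carr l L (T k L s) n, carr k L s n).
Proof.
  intros hk hl; induction n as [|n IH].
  (* All three minima vanish since [k] and [l] are nonnegative, so the initial carriers just
     swap. *)
  - cbn [carr]; rewrite (R_w k 0 0 l 0 0 0 0 0); [triple_lia | ..];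
      cbn [w1 w2 w3]; lia.
  - cbn [carr]; rewrite !T_at, yang_baxter_crossing, IH; reflexivity.
Qed.

Theorem mainTheorem8 (k l : Z) (hk : 1 <= k) (hl : 1 <= l)
  (s : Z -> triple) (L : Z) (hs : is_state s)
  (hL : forall i, i < L -> s i = V) :
  forall i, T k L (T l L s) i = T l L (T k L s) i.
Proof.
  intros i; destruct (Z.ltb_spec i L) as [Hi | Hi].
  - apply Z.ltb_lt in Hi; unfold T; rewrite Hi; reflexivity.
  - replace i with (L + Z.of_nat (Z.to_nat (i - L))) by lia.
    rewrite !T_at, yang_baxter_fst, R_carr by lia; reflexivity.
Qed.
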